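(* Let $E$ be a graph satisfying Condition (L) and let $R$ be a unital commutative ring. If $A$ is a ring and $\psi: L_R(E)\to A$ is a homomorphism with the property that $\psi(rv)\neq 0$ for every $v\in E^0$ and every $r\in R\setminus\{0\}$, then $\psi$ is injective.
   Context: Graphs. A graph $E=(E^0,E^1,r,s)$ consists of sets $E^0$ (vertices) and $E^1$ (edges), of arbitrary cardinality, and maps $r,s:E^1\to E^0$ (range and source). For $v\in E^0$ put $vE^1=s^{-1}(v)$. A vertex $v$ is regular if $vE^1$ is finite and nonempty; $E^0_{\rm reg}$ is the set of regular vertices. A finite path of positive length is a sequence $\alpha=\alpha_1\cdots\alpha_n$ of edges ($n\ge 1$) with $r(\alpha_i)=s(\alpha_{i+1})$; $|\alpha|=n$, $s(\alpha)=s(\alpha_1)$, $r(\alpha)=r(\alpha_n)$. It is a closed path if $r(\alpha)=s(\alpha)$, and a cycle if it is a closed path such that none of the vertices $s(\alpha_1),\dots,s(\alpha_n)$ are repeated. An exit for $\alpha$ is an edge $f\in E^1$ such that for some $1\le i\le |\alpha|$, $s(f)=s(\alpha_i)$ but $f\neq\alpha_i$. $E$ satisfies Condition (L) if every cycle has an exit. Leavitt path algebras. Rings and algebras are associative but need not be unital; homomorphisms here are ring homomorphisms. Introduce formal symbols $e^*$ for $e\in E^1$. A Leavitt $E$-family in a ring is a collection of elements $\{v,e,e^*\mid v\in E^0,e\in E^1\}$ satisfying: (V) $v^2=v$, and $vw=0$ for distinct $v,w\in E^0$; (E1) $s(e)e=er(e)=e$ for all $e\in E^1$; (E2) $e^*s(e)=r(e)e^*=e^*$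 for all $e\in E^1$; (CK1) $e^*e=r(e)$, and $e^*f=0$ for distinct $e,f\in E^1$; (CK2) $v=\sum_{e\in vE^1}ee^*$ for all $v\in E^0_{\rm reg}$. The Leavitt path algebra $L_R(E)$ is the universal $R$-algebra generated by a Leavitt $E$-family $\{v,e,e^*\}$: every $R$-algebra containing a Leavitt $E$-family receives a unique $R$-algebra homomorphism from $L_R(E)$ carrying the generators to the corresponding elements. *)

(* Defs.v *)
From HB Require Import structures.
From mathcomp Require Import all_boot all_order all_algebra.
From mathcomp Require Import boolp classical_sets functions cardinality fsbigop.

Set Implicit Arguments.
Unset Strict Implicit.
Unset Printing Implicit Defensive.

Import GRing.Theory.

Local Open Scope classical_set_scope.
Local Open Scope ring_scope.

(* The product of a non-unital ring is that of [semigroupType], written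
   [(x * y)%g]; the notation [*] of [ring_scope] stays reserved for unital
   rings. *)
HB.mixin Record Zmodule_Semigroup_isNuRing A
    of GRing.Zmodule A & Semigroup A := {
  numulDl : forall x y z : A, ((x + y)%R * z)%g = (x * z)%g + (y * z)%g;
  numulDr : forall x y z : A, (x * (y + z)%R)%g = (x * y)%g + (x * z)%g
}.

#[short(type="nuRingType")]
HB.structure Definition NuRing :=
  {A of GRing.Zmodule A & Semigroup A & Zmodule_Semigroup_isNuRing A}.

HB.mixin Record NuRing_Lmodule_isNuAlgebra (R : comPzRingType) A
    of NuRing A & GRing.Lmodule R A := {
  nuscaleAl : forall (r : R) (x y : A), r *: (x * y)%g = ((r *: x)%R * y)%g;
  nuscaleAr : forall (r : R) (x y : A), r *: (x * y)%g = (x * (r *: y)%R)%g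
}.

#[short(type="nuAlgType")]
HB.structure Definition NuAlgebra (R : comPzRingType) :=
  {A of NuRing A & GRing.Lmodule R A & NuRing_Lmodule_isNuAlgebra R A}.

HB.structure Definition NuRMorphism (A B : nuRingType) :=
  {f of Algebra.isNmodMorphism A B f & isMultiplicative A B f}.

Notation "{ 'nurmorphism' A -> B }" := (NuRMorphism.type A%type B%type)
  (at level 0, A at level 98, B at level 99,
   format "{ 'nurmorphism'  A  ->  B }") : type_scope.

Definition nualg_morphism (R : comPzRingType) (A B : nuAlgType R) (f : A -> B) :=
  [/\ forall x y, f (x + y) = f x + f y,
      forall x y, f (x * y)%g = (f x * f y)%g
    & forall r x, f (r *: x) = r *: f x].

Record graph := Graph {
  vertex : choiceType;
  edge : choiceType;
  src : edge -> vertex;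
  rng : edge -> vertex
}.

Section Graphs.
Variable E : graph.
Implicit Types (v : vertex E) (e f : edge E) (p : seq (edge E)).

Definition edges_from v : set (edge E) := [set e | src e = v].

Definition regular v := finite_set (edges_from v) /\ edges_from v !=set0.

(* A finite path of positive length is a nonempty sequence of edges, given by
   its first edge [e] and the sequence [p] of the other ones. *)
Definition is_path e p := path (fun f g => rng f == src g) e p.
Definition path_src e p := src e.
Definition path_rng e p := rng (last e p).

Definition closed_path e p := is_path e p /\ path_rng e p = path_src e p.

Definition graph_cycle e p :=
  closed_path e p /\ uniq [seq src f | f <- e :: p].

Definition path_exit e p f :=
  exists2 g, g \in e :: p & src f = src g /\ f <> g.

Definition condition_L :=
  forall e p, graph_cycle e p -> exists f, path_exit e p f.

Record leavitt_family (A : nuRingType)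
    (V : vertex E -> A) (X Xs : edge E -> A) : Prop := LeavittFamily {
  lf_idem v : (V v * V v)%g = V v;
  lf_orth v w : v <> w -> (V v * V w)%g = 0;
  lf_src e : (V (src e) * X e)%g = X e;
  lf_rng e : (X e * V (rng e))%g = X e;
  lf_srcs e : (Xs e * V (src e))%g = Xs e;
  lf_rngs e : (V (rng e) * Xs e)%g = Xs e;
  lf_CK1 e : (Xs e * X e)%g = V (rng e);
  lf_CK1_orth e f : e <> f -> (Xs e * X f)%g = 0;
  lf_CK2 v : regular v -> V v = \sum_(e \in edges_from v) (X e * Xs e)%g
}.

End Graphs.

Record leavitt_path_algebra (R : comPzRingType) (E : graph) (L : nuAlgType R)
    (V : vertex E -> L) (X Xs : edge E -> L) : Prop := LeavittPathAlgebra {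
  lpa_family : leavitt_family V X Xs;
  lpa_universal : forall (A : nuAlgType R)
      (V' : vertex E -> A) (X' Xs' : edge E -> A),
    leavitt_family V' X' Xs' ->
    exists! f : L -> A,
      [/\ nualg_morphism f, forall v, f (V v) = V' v,
          forall e, f (X e) = X' e & forall e, f (Xs e) = Xs' e]
}.

(* Main.v *)
From HB Require Import structures.
Require Import Defs.
From mathcomp Require Import all_boot all_algebra.
From mathcomp Require Import boolp classical_sets cardinality fsbigop.

Import GRing.Theory.
Local Open Scope ring_scope.

Set Implicit Arguments.
Unset Strict Implicit.
Unset Printing Implicit Defensive.

(** A homomorphism that kills no nonzero multiple [r *: V v] of a vertex is
    injective as soon as every nonzero two-sided ideal contains such a
    multiple.  So all the work is in [lpa_reduction]: if Condition (L) holds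
    and [x <> 0], then [a x b = r v] for some [a], [b], some vertex [v] and
    some nonzero scalar [r].  Combinations of paths ending at a given vertex
    are handled together with their coefficients, and are called formally
    nonzero when one of these is nonzero; right multiplication by an edge
    leaving that vertex preserves this ([path_polyX]).

    Ghost edges are removed first.  Multiplying [x] by a suitable vertex [v] on
    the right keeps it nonzero ([lpa_mulV_neq0]), and [x v] has the form
    [y + sum z_e e^*] where [y] is a combination of paths ending at [v], the
    [e] are finitely many edges leaving [v], and the [z_e] have the same form
    with shorter ghost parts ([lpa_ghost_form]).  By (CK1), right multiplication
    by an edge [f] leaving [v] gives [y f + z_f].  If [y] is formally nonzero
    and some [f] does not occur in the sum, then [y f] is a formally nonzero
    combination of paths.  If every edge leaving [v] occurs, then [v] is a sink
    and there is nothing to remove, or (CK2) gives [x v = sum (x f) f^*], so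
    that some [x f] is nonzero, and it has a shorter ghost part
    ([ghost_form_mul_path_poly]).

    A formally nonzero combination [y] of paths ending at [v] is then cut down
    to a single term.  Let [p] be a shortest path occurring in [y], with
    coefficient [r], and let [t] be a path from [v] to [u].  Then
    [(p t)^* y t] is [r u] plus the contribution of the paths [p g] with [g] a
    nontrivial closed path at [v], and the one of [p g] vanishes unless [t] is
    a prefix of [g t], that is, of the periodic path [g g g ...].  Condition
    (L) provides a [t] which is a prefix of none of these finitely many
    periodic paths, because one can leave any of them through an exit
    ([condition_L_aperiodic]). *)

(** * Sums and products in non-unital rings *)

Lemma big_uniq_sub (I : eqType) (M : nmodType) (s t : seq I) (F : I -> M) :
    uniq s -> uniq t -> {subset s <= t} ->
    (forall i, i \notin s -> F i = 0) ->
  \sum_(i <- t) F i = \sum_(i <- s) F i.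
Proof.
move=> us ut sst F0; rewrite (bigID (mem s)) /= [X in _ + X]big1 // addr0.
rewrite -big_filter; apply/perm_big/uniq_perm => //; first exact: filter_uniq.
by move=> i; rewrite mem_filter /=; case: (boolP (i \in s)) => // /sst ->.
Qed.

Section NuRing.
Variable A : nuRingType.
Implicit Types x y z : A.

Lemma nurmul0l x : (0 * x)%g = 0 :> A.
Proof. by apply: (addrI (0 * x)%g); rewrite -numulDl !addr0. Qed.

Lemma nurmul0r x : (x * 0)%g = 0 :> A.
Proof. by apply: (addrI (x * 0)%g); rewrite -numulDr !addr0. Qed.

Lemma nurmul_suml (I : Type) (s : seq I) (P : pred I) (F : I -> A) x :
  ((\sum_(i <- s | P i) F i) * x)%g = \sum_(i <- s | P i) (F i * x)%g.
Proof.
by apply: (big_morph (fun y => (y * x)%g)) => [y z|]; rewrite ?numulDl ?nurmul0l.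
Qed.

Lemma nurmul_sumr (I : Type) (s : seq I) (P : pred I) (F : I -> A) x :
  (x * (\sum_(i <- s | P i) F i))%g = \sum_(i <- s | P i) (x * F i)%g.
Proof.
by apply: (big_morph (fun y => (x * y)%g)) => [y z|]; rewrite ?numulDr ?nurmul0r.
Qed.

End NuRing.

(** * Walks in graphs satisfying Condition (L) *)

Section Walks.
Variable E : graph.
Implicit Types (u v w : vertex E) (e f g : edge E) (p q s t : seq (edge E)).

Fixpoint walk u p v : bool :=
  if p is e :: p' then (src e == u) && walk (rng e) p' v else u == v.

Lemma walk_catl u p w q v : walk u p w -> walk u (p ++ q) v = walk w q v.
Proof.
elim: p u => [|e p IHp] u /= => [/eqP-> //|/andP[-> /IHp->]//].
Qed.

Lemma walk_split u p q v : walk u (p ++ q) v -> exists w, walk u p w.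
Proof.
elim: p u => [|e p IHp] u /=; first by exists u.
by case/andP=> -> /IHp[w pw]; exists w.
Qed.

Lemma walk_rcons u p e : walk u p (src e) -> walk u (rcons p e) (rng e).
Proof. by move=> pe; rewrite -cats1 (walk_catl _ _ pe) /= !eqxx. Qed.

Lemma walk_cons_closed v e p : walk v (e :: p) v -> closed_path e p.
Proof.
move=> /= /andP[/eqP<-]; rewrite /closed_path /is_path /path_rng /path_src.
move: (src e) => w; elim: p e => [|f p IHp] e /=; first by move/eqP.
by case/andP=> /eqP<- /IHp[-> ->]; rewrite eqxx.
Qed.

(** In a walk, [e :: s] is then a closed path; this is how a closed path that is
    not a cycle gets shortened. *)
Lemma src_repeat p :
  ~~ uniq [seq src e | e <- p] ->
  exists q s t e f, p = q ++ (e :: s) ++ f :: t /\ src e = src f.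
Proof.
elim: p => //= e p IHp; rewrite negb_and negbK.
case: (boolP (src e \in _)) => [/mapP[f /splitPr[s t] ef] _|_ /= /IHp].
  by exists [::], s, t, e, f.
by move=> [q [s [t [f [g [-> fg]]]]]]; exists (e :: q), s, t, f, g.
Qed.

(** Shrinking a closed path as long as it repeats a vertex ends with a cycle,
    and the exit of that cycle is a second edge leaving one of its vertices. *)
Lemma condition_L_branch v p :
    condition_L E -> p <> [::] -> walk v p v ->
  exists q e f, [/\ walk v q (src e), src f = src e & f <> e].
Proof.
move=> LE; move: {2}(size p) (leqnn (size p)) => n.
elim: n v p => [|n IHn] v p; first by rewrite leqn0 => /nilP.
move=> sp p0 pv.
have [up|/src_repeat[q [s [t [f [g [pE fg]]]]]]] :=
    boolP (uniq [seq src f | f <- p]).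
  case: p p0 pv up {sp} => // e p _ pv up.
  have [f [g gp [fg ?]]] := LE e p (conj (walk_cons_closed pv) up).
  have [q [t pE]] : exists q t, e :: p = q ++ g :: t.
    by case/splitPr: gp => q t; exists q, t.
  exists q, g, f; split=> //; rewrite pE in pv.
  have [w qw] := walk_split pv.
  by move: pv; rewrite (walk_catl _ _ qw) /= => /andP[/eqP->].
rewrite {p p0}pE in pv sp.
have [w qw] := walk_split pv; move: pv; rewrite (walk_catl _ _ qw) => pv.
have [w' sw] := walk_split pv; move: pv; rewrite (walk_catl _ _ sw) /=.
case/andP=> /eqP gw' _.
have ww' : w = w' by case/andP: (sw) => /eqP<- _; rewrite fg.
rewrite -{w'}ww' in sw gw'.
have ss : (size (f :: s) <= n)%N.
  move: sp; rewrite size_cat size_cat /= addnCA addnS addnS ltnS.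
  by apply: leq_trans; rewrite leq_addr.
have [//|q' [e' [f' [qw' ? ?]]]] := IHn w (f :: s) ss _ sw.
by exists (q ++ q'), e', f'; split=> //; rewrite (walk_catl _ _ qw).
Qed.

(** Once a path has left the periodic path [p p p ...], so have all its
    extensions. *)
Lemma prefix_shift_cat t s p : prefix (t ++ s) (p ++ t ++ s) -> prefix t (p ++ t).
Proof.
by move=> /catl_prefix; rewrite catA !prefixE takel_cat // size_cat leq_addl.
Qed.

(** The periodic paths are avoided one at a time.  If no extension of [t] left
    [p p p ...], each edge of such an extension would be determined by the
    preceding ones; but [t] ends on a rotation of the closed path [p], from
    which two distinct edges with the same source can be reached. *)
Lemma condition_L_aperiodic v (ps : seq (seq (edge E))) :
    condition_L E ->
  exists u t, walk v t u /\
    forall p, p \in ps -> p <> [::] -> walk v p v -> ~~ prefix t (p ++ t).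
Proof.
move=> LE; elim: ps => [|p ps [u [t [vt IHt]]]].
  by exists v, [::]; split=> //=.
have [pN0|p0] := pselect (p <> [::] /\ walk v p v); last first.
  exists u, t; split=> // q; rewrite inE => /orP[/eqP->|/IHt//] ? ?.
  by case: p0.
case: pN0 => pN0 pv.
have [[s [w [sw Ns]]]|per] :=
    pselect (exists s w, walk u s w /\ ~~ prefix (t ++ s) (p ++ t ++ s)).
  exists w, (t ++ s); split; first by rewrite (walk_catl _ _ vt).
  move=> q; rewrite inE => /orP[/eqP->//|/IHt{}IHt q0 qv].
  by apply: contra (IHt q0 qv); apply: prefix_shift_cat.
have {}per s w : walk u s w -> prefix (t ++ s) (p ++ t ++ s).
  by move=> sw; apply: contrapT => /negP ?; apply: per; exists s, w.
have /prefixP[d tE] : prefix t (p ++ t).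
  by have := per [::] u (eqxx u); rewrite !cats0.
have dN0 : d <> [::].
  move=> d0; apply: pN0; apply/nilP; rewrite /nilp.
  by have /eqP := f_equal size tE; rewrite d0 cats0 size_cat -{2}[size t]add0n eqn_add2r.
have ud : walk u d u by rewrite -(walk_catl _ _ vt) -tE (walk_catl _ _ pv).
(* [d] is the rotation of [p] that starts at the end of [t]. *)
have [q [e [f [qe fe]]]] := condition_L_branch LE dN0 ud; case.
(* [p] is nonempty, so [p ++ t ++ q] already fixes the edge following
   [t ++ q]. *)
have nx g : src g = src e -> g = nth e (p ++ t ++ q) (size (t ++ q)).
  move=> ge; have /per : walk u (rcons q g) (rng g) by apply: walk_rcons; rewrite ge.
  case/prefixP=> r E1.
  have {E1} : (p ++ t ++ q) ++ [:: g] = (t ++ q) ++ g :: r.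
    by move: E1; rewrite -cats1 -!catA.
  move/(f_equal (fun l => nth e l (size (t ++ q)))).
  rewrite nth_cat [in RHS]nth_cat ltnn subnn /= => <-.
  by rewrite [size (p ++ _)]size_cat; case: (p) pN0 => // ? ? _; rewrite ltnS leq_addl.
by rewrite (nx f) // [RHS]nx.
Qed.

End Walks.

(** * Monomials in a Leavitt family *)

Section Monomials.
Variables (E : graph) (A : nuRingType).
Variables (V : vertex E -> A) (X Xs : edge E -> A).
Hypothesis fam : leavitt_family V X Xs.
Implicit Types (u v w : vertex E) (e f g : edge E) (p q s t : seq (edge E)).

Definition path_mon v p : A := foldr (fun e x => (X e * x)%g) (V v) p.
Definition ghost_mon v p : A := foldr (fun e x => (x * Xs e)%g) (V v) p.

Lemma path_mon_src u p v : walk u p v -> (V u * path_mon v p)%g = path_mon v p.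
Proof.
case: p => [|e p] /= => [/eqP->|/andP[/eqP<- _]]; first exact: lf_idem fam v.
by rewrite mulgA (lf_src fam).
Qed.

Lemma path_mon_src_orth w u p v :
  w <> u -> walk u p v -> (V w * path_mon v p)%g = 0.
Proof.
move=> wu /path_mon_src <-.
by rewrite mulgA (lf_orth fam wu) nurmul0l.
Qed.

Lemma ghost_mon_src u p v : walk u p v -> (ghost_mon v p * V u)%g = ghost_mon v p.
Proof.
case: p => [|e p] /= => [/eqP->|/andP[/eqP<- _]]; first exact: lf_idem fam v.
by rewrite -mulgA (lf_srcs fam).
Qed.

Lemma path_mon_rng v p : (path_mon v p * V v)%g = path_mon v p.
Proof.
by elim: p => [|e p IHp] /=; rewrite ?(lf_idem fam) // -mulgA IHp.
Qed.

Lemma path_mon_cat v p q w :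
  walk v q w -> (path_mon v p * path_mon w q)%g = path_mon w (p ++ q).
Proof.
by move=> vq; elim: p => [|e p IHp] /=; rewrite ?path_mon_src // -mulgA IHp.
Qed.

Lemma path_mon_rcons p e :
  (path_mon (src e) p * X e)%g = path_mon (rng e) (rcons p e).
Proof.
elim: p => [|f p IHp] /=; first by rewrite (lf_src fam) (lf_rng fam).
by rewrite -mulgA IHp.
Qed.

Lemma ghost_path_mon u p v :
  walk u p v -> (ghost_mon v p * path_mon v p)%g = V v.
Proof.
elim: p u => [|e p IHp] u /=; first by rewrite (lf_idem fam).
case/andP=> _ pv; rewrite mulgA -(mulgA _ (Xs e)) (lf_CK1 fam).
by rewrite (ghost_mon_src pv) (IHp _ pv).
Qed.

Lemma ghost_path_mon_orth u p v w q :
    walk u p v -> (size p <= size q)%N -> ~~ prefix p q ->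
  (ghost_mon v p * path_mon w q)%g = 0.
Proof.
elim: p u q => [|e p IHp] u [|f q] //= /andP[_ pv] spq.
rewrite mulgA -(mulgA _ (Xs e)); case: eqP => [<-|ef] /= npq.
  by rewrite (lf_CK1 fam) (ghost_mon_src pv) (IHp _ _ pv).
by rewrite (lf_CK1_orth fam ef) nurmul0r nurmul0l.
Qed.

End Monomials.

(** * Combinations of paths *)

Section PathPolynomials.
Variables (R : comPzRingType) (E : graph) (L : nuAlgType R).
Variables (V : vertex E -> L) (X Xs : edge E -> L).
Hypothesis fam : leavitt_family V X Xs.
Implicit Types (u v w : vertex E) (e f g : edge E) (p q : seq (edge E)).
Implicit Types (x y z : L) (r : R) (c : seq (edge E) -> R).

Local Notation path_mon := (path_mon V X).
Local Notation ghost_mon := (ghost_mon V Xs).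

(** A linear combination of paths ending at [v] together with its coefficients:
    [c] is part of the data because distinct [c] may a priori give the same
    [y].  The vertex [v] is needed to interpret the empty path. *)
Definition path_poly v c y : Prop :=
  exists s : seq (seq (edge E)),
  [/\ uniq s,
      forall p, c p <> 0 -> p \in s /\ exists u, walk u p v
    & y = \sum_(p <- s) c p *: path_mon v p].

Lemma path_poly_wide v c y (s : seq (seq (edge E))) : path_poly v c y ->
  exists t, [/\ uniq t, {subset s <= t},
    forall p, c p <> 0 -> p \in t /\ exists u, walk u p v
  & y = \sum_(p <- t) c p *: path_mon v p].
Proof.
case=> s' [us cs ->]; exists (undup (s ++ s')); split.
- exact: undup_uniq.
- by move=> p ps; rewrite mem_undup mem_cat ps.
- by move=> p /cs[ps ?]; rewrite mem_undup mem_cat ps orbT.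
- apply/esym/big_uniq_sub; rewrite ?undup_uniq //.
    by move=> p ps; rewrite mem_undup mem_cat ps orbT.
  move=> p ps; have [->|/eqP/cs[]] := eqVneq (c p) 0; first by rewrite scale0r.
  by rewrite (negPf ps).
Qed.

Lemma path_poly0 v : path_poly v (fun=> 0) 0.
Proof. by exists [::]; split=> //; rewrite big_nil. Qed.

Lemma path_polyD v c d x y :
  path_poly v c x -> path_poly v d y -> path_poly v (fun p => c p + d p) (x + y).
Proof.
move=> [s [us cs xE]] /(path_poly_wide s)[t [ut st dt ->]].
exists t; split=> //.
  move=> p; have [->|/eqP/cs[/st ? ? _ //]] := eqVneq (c p) 0.
  by rewrite add0r => /dt.
rewrite xE -(big_uniq_sub us ut) // => [|p ps].
  by rewrite -big_split; apply: eq_bigr => p _; rewrite scalerDl.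
have [->|/eqP/cs[]] := eqVneq (c p) 0; first by rewrite scale0r.
by rewrite (negPf ps).
Qed.

Lemma path_polyZ v c r x :
  path_poly v c x -> path_poly v (fun p => r * c p) (r *: x).
Proof.
move=> [s [us cs ->]]; exists s; split=> //.
  move=> p; have [->|/eqP/cs//] := eqVneq (c p) 0.
  by rewrite mulr0.
by rewrite scaler_sumr; apply: eq_bigr => p _; rewrite scalerA.
Qed.

Lemma path_polyV v : path_poly v (fun p => if p is [::] then 1 else 0) (V v).
Proof.
exists [:: [::]]; split=> //; last by rewrite big_seq1 scale1r.
by case=> // _; split; [|exists v => /=].
Qed.

(** Right multiplication by an edge is injective on paths, so coefficients are
    moved around but never added up. *)
Lemma path_polyX e c x : path_poly (src e) c x ->
  exists2 d, path_poly (rng e) d (x * X e)%g & forall p, d (rcons p e) = c p.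
Proof.
move=> [s [us cs ->]].
pose d q := let p := take (size q).-1 q in if q == rcons p e then c p else 0.
have dE p : d (rcons p e) = c p.
  by rewrite /d size_rcons /= -cats1 take_size_cat // cats1 eqxx.
exists d => //; exists [seq rcons p e | p <- s]; split.
- by rewrite map_inj_uniq //; apply: rcons_injl.
- move=> q; rewrite {1}/d; case: eqP => // qE /cs[ps [u pe]].
  split; first by apply/mapP; exists (take (size q).-1 q).
  by exists u; rewrite qE walk_rcons.
- rewrite nurmul_suml big_map; apply: eq_bigr => p _.
  by rewrite dE -nuscaleAl (path_mon_rcons fam).
Qed.

Lemma path_poly_eq0 v c y : path_poly v c y -> (forall p, c p = 0) -> y = 0.
Proof.
by move=> [s [_ _ ->]] c0; rewrite big1 // => p _; rewrite c0 scale0r.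
Qed.

Lemma path_poly_rng v c y : path_poly v c y -> (y * V v)%g = y.
Proof.
move=> [s [_ _ ->]]; rewrite nurmul_suml; apply: eq_bigr => p _.
by rewrite -nuscaleAl (path_mon_rng fam).
Qed.

(** Multiplying by [(p0 t)^*] and [t], with [p0] shortest among the paths that
    occur, isolates the coefficient of [p0]: by minimality the other paths
    that survive multiplication by [p0^*] extend [p0] by a closed path at [v],
    and [t] avoids the corresponding periodic paths. *)
Lemma path_poly_reduce v c y p :
    condition_L E -> path_poly v c y -> c p <> 0 ->
  exists (a b : L) u r, r <> 0 /\ (a * y * b)%g = r *: V u.
Proof.
move=> LE [s [us cs yE]] cp.
have ex : exists n, has (fun q => (c q != 0) && (size q == n)) s.
  exists (size p); apply/hasP; exists p; first by case: (cs p cp).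
  by rewrite eqxx andbT; apply/eqP.
case: (ex_minnP ex) => n /hasP[p0 p0s /andP[/eqP cp0 /eqP <-]] min {p cp ex n}.
have [_ [w wp0]] := cs p0 cp0.
have [u [t [vt ap]]] :=
  condition_L_aperiodic v [seq drop (size p0) q | q <- s] LE.
have wt : walk w (p0 ++ t) u by rewrite (walk_catl _ _ wp0).
exists (ghost_mon u (p0 ++ t)), (path_mon u t), u, (c p0); split=> //.
rewrite yE nurmul_sumr nurmul_suml (bigD1_seq p0) //= -nuscaleAr -nuscaleAl -mulgA.
rewrite (path_mon_cat fam) // (ghost_path_mon fam wt) big_seq_cond big1 ?addr0 //.
move=> q /andP[qs qp0]; rewrite -nuscaleAr -nuscaleAl -mulgA (path_mon_cat fam) //.
have [->|/eqP cq] := eqVneq (c q) 0; first exact: scale0r.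
suff -> : (ghost_mon u (p0 ++ t) * path_mon u (q ++ t))%g = 0 by rewrite scaler0.
have [_ [w' wq]] := cs q cq.
have [ww'|] := eqVneq w w'; last first.
  move/eqP=> ww'; rewrite -(ghost_mon_src fam wt) -mulgA.
  by rewrite (path_mon_src_orth fam (u := w')) ?nurmul0r // (walk_catl _ _ wq).
rewrite -{w'}ww' in wq.
have sp0q : (size p0 <= size q)%N.
  by apply: min; apply/hasP; exists q => //; rewrite eqxx andbT; apply/eqP.
apply: (ghost_path_mon_orth fam u wt); first by rewrite !size_cat leq_add2r.
have [/prefixP[g qE]|] := boolP (prefix p0 q); last first.
  apply: contra => /catl_prefix; rewrite !prefixE takel_cat //.
rewrite qE -catA prefix_catr // eqxx /=; apply: ap.
- by apply/mapP; exists q => //; rewrite qE drop_size_cat.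
- by move=> g0; move: qp0; rewrite qE g0 cats0 eqxx.
- by rewrite -(walk_catl _ _ wp0) -qE.
Qed.

End PathPolynomials.

(** * Removing ghost edges *)

Section GhostNormalForm.
Variables (R : comPzRingType) (E : graph) (L : nuAlgType R).
Variables (V : vertex E -> L) (X Xs : edge E -> L).
Hypothesis fam : leavitt_family V X Xs.
Implicit Types (u v w : vertex E) (e f g : edge E) (p q : seq (edge E)).
Implicit Types (x y z : L) (r : R) (c : seq (edge E) -> R).

Local Notation path_poly := (path_poly V X).

Definition in_path_span v y := exists c, path_poly v c y.

(** The span of the monomials [p q^*] where [q] starts at [v], organised by the
    first edge of [q]: a trivial [q] contributes to [y], and a [q] starting
    with [e] contributes to [z e].  Derivations have finite depth, which bounds
    the length of the [q]; induction on them replaces induction on that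
    length. *)
Inductive ghost_form : vertex E -> L -> Prop :=
  GhostForm v y (F : seq (edge E)) (z : edge E -> L) of
    in_path_span v y & uniq F & (forall e, e \in F -> src e = v)
    & (forall e, e \notin F -> z e = 0)
    & (forall e, e \in F -> ghost_form (rng e) (z e)) :
  ghost_form v (y + \sum_(e <- F) (z e * Xs e)%g).

Lemma in_path_spanD v x y :
  in_path_span v x -> in_path_span v y -> in_path_span v (x + y).
Proof. by move=> [c xc] [d yd]; eexists; apply: path_polyD xc yd. Qed.

Lemma in_path_spanX e x : in_path_span (src e) x -> in_path_span (rng e) (x * X e)%g.
Proof. by case=> c /(path_polyX fam)[d]; exists d. Qed.

Lemma in_path_span0 v : in_path_span v 0.
Proof. by eexists; apply: path_poly0. Qed.

Lemma in_path_span_ghost_form v y : in_path_span v y -> ghost_form v y.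
Proof.
move=> yv; rewrite -[y]addr0.
by have := @GhostForm v y [::] (fun=> 0) yv; rewrite big_nil; apply.
Qed.

Lemma ghost_form0 v : ghost_form v 0.
Proof. exact/in_path_span_ghost_form/in_path_span0. Qed.

Lemma ghost_formD v x1 x2 :
  ghost_form v x1 -> ghost_form v x2 -> ghost_form v (x1 + x2).
Proof.
move=> G1; elim: G1 x2 => {v x1} v y1 F1 z1 y1v u1 s1 z10 _ IH1 x2 G2.
case: G2 y1v s1 => {v x2} v y2 F2 z2 y2v u2 s2 z20 G2 y1v s1.
pose F := undup (F1 ++ F2).
have sF1 : {subset F1 <= F} by move=> e eF; rewrite mem_undup mem_cat eF.
have sF2 : {subset F2 <= F} by move=> e eF; rewrite mem_undup mem_cat eF orbT.
have uF : uniq F by apply: undup_uniq.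
rewrite -(big_uniq_sub u1 uF) // => [|e /z10->]; last by rewrite nurmul0l.
rewrite -(big_uniq_sub u2 uF) // => [|e /z20->]; last by rewrite nurmul0l.
rewrite addrACA -big_split /=.
under eq_bigr do rewrite -numulDl.
apply: (@GhostForm v (y1 + y2) F (fun e => z1 e + z2 e)) => //.
- exact: in_path_spanD.
- by move=> e; rewrite mem_undup mem_cat => /orP[/s1|/s2].
- move=> e; rewrite mem_undup mem_cat negb_or => /andP[/z10-> /z20->].
  by rewrite addr0.
move=> e _.
have G2e : ghost_form (rng e) (z2 e).
  by have [/G2|/z20->] := boolP (e \in F2); last exact: ghost_form0.
by have [/IH1/(_ _ G2e)|/z10->] := boolP (e \in F1); last by rewrite add0r.
Qed.

Lemma ghost_formZ v r x : ghost_form v x -> ghost_form v (r *: x).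
Proof.
elim=> {v x} v y F z [c yc] uF sF z0 _ IH.
rewrite scalerDr scaler_sumr; under eq_bigr do rewrite nuscaleAl.
apply: (@GhostForm v (r *: y) F (fun e => r *: z e)) => //.
- by eexists; apply: path_polyZ yc.
- by move=> e /z0->; rewrite scaler0.
Qed.

Lemma ghost_form_rng v x : ghost_form v x -> (x * V v)%g = x.
Proof.
case=> {v x} v y F z [c yc] _ sF _ _.
rewrite numulDl (path_poly_rng fam yc) nurmul_suml; congr (_ + _).
by apply: eq_big_seq => e /sF <-; rewrite -mulgA (lf_srcs fam).
Qed.

Lemma ghost_form_mulXs e x : ghost_form (rng e) x -> ghost_form (src e) (x * Xs e)%g.
Proof.
move=> Gx; have := @GhostForm (src e) 0 [:: e] (fun f => if f == e then x else 0).
rewrite big_seq1 eqxx add0r; apply=> //.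
- exact: in_path_span0.
- by move=> f; rewrite inE => /eqP->.
- by move=> f; rewrite inE => /negPf->.
- by move=> f; rewrite inE => /eqP->; rewrite eqxx.
Qed.

Lemma sum_ghost_mulX (F : seq (edge E)) (z : edge E -> L) e :
    uniq F -> (forall f, f \notin F -> z f = 0) ->
    (forall f, f \in F -> (z f * V (rng f))%g = z f) ->
  ((\sum_(f <- F) (z f * Xs f)%g) * X e)%g = z e.
Proof.
move=> uF z0 zV; rewrite nurmul_suml.
have [eF|eF] := boolP (e \in F).
  rewrite (bigD1_seq e) //= -mulgA (lf_CK1 fam) zV // big1 ?addr0 // => f /eqP fe.
  by rewrite -mulgA (lf_CK1_orth fam fe) nurmul0r.
rewrite z0 // big_seq big1 // => f fF; rewrite -mulgA (lf_CK1_orth fam) ?nurmul0r //.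
by move=> fe; rewrite -fe fF in eF.
Qed.

Lemma ghost_form_mulX e x : ghost_form (src e) x -> ghost_form (rng e) (x * X e)%g.
Proof.
have [v ve] : exists v, v = src e by exists (src e).
rewrite -ve => G; case: G ve => {}v y F z yv uF sF z0 G ev.
rewrite numulDl sum_ghost_mulX //; last by move=> f /G/ghost_form_rng.
apply: ghost_formD; first by apply/in_path_span_ghost_form/in_path_spanX; rewrite -ev.
by have [/G//|/z0->] := boolP (e \in F); apply: ghost_form0.
Qed.

(** Ghost edges can be cancelled by right multiplication.  The extra summand [y]
    makes the induction work: passing from [x] to [x * X e] adds the
    combination of paths [y * X e] to the shorter form [z e]. *)
Lemma ghost_form_mul_path_poly v x y : ghost_form v x -> in_path_span v y ->
  y + x <> 0 -> exists b w c p, path_poly w c ((y + x) * b)%g /\ c p <> 0.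
Proof.
move=> G; elim: G y => {v x} v y' F z yv' uF sF z0 G IH y yv.
have yX e := sum_ghost_mulX e uF z0 (fun f fF => ghost_form_rng (G f fF)).
have := in_path_spanD yv yv'; rewrite addrA.
move: (y + y') => {yv yv'}y' => {y} yv; move: y' yv => y yv.
set S := \sum_(e <- F) _ in yX *; move=> x0.
(* Some [e] of [F] does not kill [y + S]: the induction hypothesis applies. *)
have [[e [eF xe0]]|xe0] := pselect (exists e, e \in F /\ ((y + S) * X e)%g <> 0).
  move: xe0; rewrite numulDl yX => xe0; have ev := sF e eF.
  have [|b [w [c [p [bw cp]]]]] := IH e eF (y * X e)%g _ xe0.
    by apply: in_path_spanX; rewrite ev.
  by exists (X e * b)%g, w, c, p; rewrite mulgA numulDl yX.
have {}xe0 e : e \in F -> ((y + S) * X e)%g = 0.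
  by move=> eF; apply: contrapT => ?; apply: xe0; exists e.
(* Otherwise [y] is formally nonzero: if [y] were [0], then [S] would be killed
   by all the edges of [F], and so vanish. *)
case: (yv) => c yc; have [[p cp]|c0] := pselect (exists p, c p <> 0); last first.
  have y0 : y = 0.
    by apply: (path_poly_eq0 yc) => p; apply: contrapT => ?; apply: c0; exists p.
  case: x0; rewrite y0 add0r /S big_seq big1 // => e eF.
  by have := xe0 e eF; rewrite y0 add0r yX => ->; rewrite nurmul0l.
have [[f [fv fF]]|allF] := pselect (exists f, src f = v /\ f \notin F).
  rewrite -fv in yc; have [d yd dE] := path_polyX fam yc.
  exists (X f), (rng f), d, (rcons p f); rewrite dE; split=> //.
  by rewrite numulDl yX z0 // addr0.
have {}allF f : src f = v -> f \in F.
  by move=> fv; apply: contrapT => /negP ?; apply: allF; exists f.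
have xv : ((y + S) * V v)%g = y + S.
  exact/ghost_form_rng/GhostForm.
have [F0|F0] := eqVneq F [::].
  exists (V v), v, c, p; split=> //; rewrite xv.
  by rewrite /S F0 big_nil addr0.
have EF : edges_from v = [set` F]%classic.
  by apply/seteqP; split=> [f /= /allF|f /= /sF].
have reg : regular v.
  split; first by rewrite EF; apply: finite_seq.
  case: F F0 EF {IH G uF sF z0 yX S x0 xe0 allF xv} => // e F _ ->.
  by exists e => /=; rewrite inE eqxx.
(* All edges leaving the regular vertex [v] kill [y + S], hence so does [v]. *)
case: x0; rewrite -xv (lf_CK2 fam reg) EF -fsbig_seq // nurmul_sumr.
rewrite big_seq big1 // => e eF.
by rewrite mulgA xe0 // nurmul0l.
Qed.

End GhostNormalForm.

(** * Generation of the Leavitt path algebra *)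

Section Subalgebra.
Variables (R : comPzRingType) (L : nuAlgType R) (S : {pred L}).
Hypotheses (subD : GRing.subsemimod_closed S) (subM : mulg_closed S).

(** [S] is made into an algebra of its own so that the universal property can
    be applied to it. *)
Record subalg := Subalg { subalg_val : L; _ : subalg_val \in S }.

HB.instance Definition _ := [isSub for subalg_val].
HB.instance Definition _ := [Choice of subalg by <:].
HB.instance Definition _ := GRing.SubChoice_isSubLmodule.Build R L S subalg subD.
HB.instance Definition _ := SubChoice_isSubSemigroup.Build L S subalg subM.

Fact subalg_mulDl (x y z : subalg) : ((x + y)%R * z)%g = (x * z)%g + (y * z)%g.
Proof. by apply: val_inj; rewrite raddfD !valM raddfD numulDl. Qed.
Fact subalg_mulDr (x y z : subalg) : (x * (y + z)%R)%g = (x * y)%g + (x * z)%g.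
Proof. by apply: val_inj; rewrite raddfD !valM raddfD numulDr. Qed.
HB.instance Definition _ :=
  Zmodule_Semigroup_isNuRing.Build subalg subalg_mulDl subalg_mulDr.

Fact subalg_scaleAl r (x y : subalg) : r *: (x * y)%g = ((r *: x)%R * y)%g.
Proof. by apply: val_inj; rewrite linearZ !valM linearZ /= nuscaleAl. Qed.
Fact subalg_scaleAr r (x y : subalg) : r *: (x * y)%g = (x * (r *: y)%R)%g.
Proof. by apply: val_inj; rewrite linearZ !valM linearZ /= nuscaleAr. Qed.
HB.instance Definition _ :=
  NuRing_Lmodule_isNuAlgebra.Build R subalg subalg_scaleAl subalg_scaleAr.

(** The universal map into the subalgebra [S], followed by the inclusion, is the
    identity by uniqueness; hence [S] is everything. *)
Lemma lpa_generated (E : graph) (V : vertex E -> L) (X Xs : edge E -> L) :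
    leavitt_path_algebra V X Xs ->
    (forall v, V v \in S) -> (forall e, X e \in S) -> (forall e, Xs e \in S) ->
  forall x, x \in S.
Proof.
move=> [fam univ] SV SX SXs.
pose V' v : subalg := Sub (V v) (SV v); pose X' e : subalg := Sub (X e) (SX e).
pose Xs' e : subalg := Sub (Xs e) (SXs e).
have fam' : leavitt_family V' X' Xs'.
  split=> [v|v w vw|e|e|e|e|e|e f ef|v reg_v]; apply: val_inj; rewrite ?valM.
  - exact: lf_idem fam _.
  - exact: (lf_orth fam).
  - exact: (lf_src fam).
  - exact: (lf_rng fam).
  - exact: (lf_srcs fam).
  - exact: (lf_rngs fam).
  - exact: (lf_CK1 fam).
  - exact: (lf_CK1_orth fam).
  - have [finv _] := reg_v.
    rewrite [LHS](lf_CK2 fam reg_v) !fsbig_finite // raddf_sum.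
    exact: eq_bigr.
have [f [[[fD fM fZ] fV fX fXs] _]] := univ _ _ _ _ fam'.
have [g [_ g_unique]] := univ _ _ _ _ fam.
move=> x; suff -> : x = val (f x) by apply: valP.
transitivity (g x); first by rewrite (g_unique id).
rewrite (g_unique (fun y => val (f y))) //; split=> [|v|e|e]; rewrite ?fV ?fX ?fXs //.
by split=> [y z|y z|r y]; rewrite ?fD ?fM ?fZ ?raddfD ?valM ?linearZ.
Qed.

End Subalgebra.

(** * Reduction and uniqueness *)

Section Reduction.
Variables (R : comPzRingType) (E : graph) (L : nuAlgType R).
Variables (V : vertex E -> L) (X Xs : edge E -> L).
Hypothesis lpa : leavitt_path_algebra V X Xs.
Let fam := lpa_family lpa.

Local Notation ghost_form := (ghost_form V X Xs).

Lemma lpa_ind (P : L -> Prop) :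
    P 0 -> (forall x y, P x -> P y -> P (x + y)) -> (forall r x, P x -> P (r *: x)) ->
    (forall x y, P x -> P y -> P (x * y)%g) ->
    (forall v, P (V v)) -> (forall e, P (X e)) -> (forall e, P (Xs e)) ->
  forall x, P x.
Proof.
move=> P0 PD PZ PM PV PX PXs x; pose S : {pred L} := fun y => `[< P y >].
suff /asboolP : x \in S by [].
apply: (@lpa_generated R L S _ _ E V X Xs lpa) => [||v|e|e]; last 3 first.
- exact/asboolP.
- exact/asboolP.
- exact/asboolP.
- split; first split; first exact/asboolP.
    by move=> y z /asboolP Py /asboolP Pz; apply/asboolP/PD.
  by move=> r y /asboolP Py; apply/asboolP/PZ.
- by move=> y z /asboolP Py /asboolP Pz; apply/asboolP/PM.
Qed.

(** The sums of finitely many distinct vertices are right local units.  Asking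
    for all large [t] rather than for one makes the property additive. *)
Lemma lpa_local_unit x : exists s : seq (vertex E), forall t,
  uniq t -> {subset s <= t} -> x = \sum_(v <- t) (x * V v)%g.
Proof.
have gen y w : (y * V w)%g = y -> exists s : seq (vertex E), forall t,
    uniq t -> {subset s <= t} -> y = \sum_(v <- t) (y * V v)%g.
  move=> yw; exists [:: w] => t ut wt.
  rewrite (bigD1_seq w) ?wt ?inE //= yw big1 ?addr0 // => v vw.
  by rewrite -yw -mulgA (lf_orth fam) ?nurmul0r //; apply/eqP; rewrite eq_sym.
elim/lpa_ind: x => [|x y [s xs] [t yt]|r x [s xs]|x y _ [t yt]|v|e|e].
- by exists [::] => t _ _; rewrite big1 // => v _; rewrite nurmul0l.
- exists (s ++ t) => s' us' sub.
  under eq_bigr do rewrite numulDl; rewrite big_split /=.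
  by rewrite -xs -?yt // => v ?; apply: sub; rewrite mem_cat; apply/orP; [right|left].
- exists s => t ut st; rewrite {1}(xs t) // scaler_sumr.
  by apply: eq_bigr => v _; rewrite nuscaleAl.
- exists t => s us ts; rewrite {1}(yt s) // nurmul_sumr.
  by apply: eq_bigr => v _; rewrite mulgA.
- exact: gen (lf_idem fam v).
- exact: gen (lf_rng fam e).
- exact: gen (lf_srcs fam e).
Qed.

Lemma lpa_mulV_neq0 x : x <> 0 -> exists v, (x * V v)%g <> 0.
Proof.
move=> x0; apply: contrapT => nv; apply: x0.
have [s /(_ (undup s))->] := lpa_local_unit x; last by move=> v; rewrite mem_undup.
  by rewrite big1 // => v _; apply: contrapT => ?; apply: nv; exists v.
exact: undup_uniq.
Qed.

(** Being in normal form at every vertex is stable under right multiplication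
    by the generators, by (CK1); as these generate, it is stable under right
    multiplication by everything, and vertices are in normal form. *)
Lemma lpa_ghost_form x v : ghost_form v (x * V v)%g.
Proof.
pose S y := forall v, ghost_form v (y * V v)%g.
suff : S x /\ forall y, S y -> S (y * x)%g by case=> /(_ v).
have SV w y : S y -> S (y * V w)%g.
  move=> Sy u; rewrite -mulgA; have [->|/eqP wu] := eqVneq w u.
    by rewrite (lf_idem fam).
  by rewrite (lf_orth fam wu) nurmul0r; apply: ghost_form0.
have SX e y : S y -> S (y * X e)%g.
  move=> Sy u; rewrite -(lf_rng fam e) -!mulgA; have [<-|/eqP wu] := eqVneq (rng e) u.
    rewrite (lf_idem fam) (lf_rng fam) -(lf_src fam e) mulgA.
    exact: ghost_form_mulX.
  by rewrite (lf_orth fam wu) !nurmul0r; apply: ghost_form0.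
have SXs e y : S y -> S (y * Xs e)%g.
  move=> Sy u; rewrite -(lf_srcs fam e) -!mulgA; have [<-|/eqP wu] := eqVneq (src e) u.
    rewrite (lf_idem fam) (lf_srcs fam) -(lf_rngs fam e) mulgA.
    exact: ghost_form_mulXs.
  by rewrite (lf_orth fam wu) !nurmul0r; apply: ghost_form0.
have SVw w : S (V w).
  move=> u; have [->|/eqP wu] := eqVneq w u.
    rewrite (lf_idem fam); apply: in_path_span_ghost_form.
    by eexists; apply: path_polyV.
  by rewrite (lf_orth fam wu); apply: ghost_form0.
elim/lpa_ind: x => [|x y [Sx xS] [Sy yS]|r x [Sx xS]|x y [Sx xS] [Sy yS]|w|e|e].
- split=> [u|y _ u]; rewrite ?nurmul0r nurmul0l; exact: ghost_form0.
- split=> [u|z Sz u]; first by rewrite numulDl; apply: ghost_formD.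
  by rewrite numulDr numulDl; apply: ghost_formD; [apply: xS|apply: yS].
- split=> [u|z Sz u]; first by rewrite -nuscaleAl; apply: ghost_formZ.
  by rewrite -nuscaleAr -nuscaleAl; apply/ghost_formZ/xS.
- by split=> [|z Sz]; [apply: yS|rewrite mulgA; apply/yS/xS].
- by split=> // y; apply: SV.
- by split=> [|y]; [rewrite -(lf_src fam e); apply: SX|apply: SX].
- by split=> [|y]; [rewrite -(lf_rngs fam e); apply: SXs|apply: SXs].
Qed.

(** Both halves of the argument, removing the ghost edges and isolating one
    path, only multiply [x] on the left and on the right, so they combine. *)
Lemma lpa_reduction x : condition_L E -> x <> 0 ->
  exists (a b : L) v r, r <> 0 /\ (a * x * b)%g = r *: V v.
Proof.
move=> LE /lpa_mulV_neq0[v xv].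
have [|b [w [c [p]]]] := ghost_form_mul_path_poly fam (lpa_ghost_form x v) (in_path_span0 _ _ v).
  by rewrite add0r.
rewrite add0r => -[yc cp].
have [a [b' [u [r [r0 rE]]]]] := path_poly_reduce fam LE yc cp.
by exists a, (V v * b * b')%g, u, r; split=> //; rewrite -rE !mulgA.
Qed.

End Reduction.

Theorem theorem3p26 (E : graph) (R : comPzRingType)
    (L : nuAlgType R) (V : vertex E -> L) (X Xs : edge E -> L)
    (A : nuRingType) (psi : {nurmorphism L -> A}) :
  condition_L E ->
  leavitt_path_algebra V X Xs ->
  (forall (v : vertex E) (r : R), r <> 0 -> psi (r *: V v) <> 0) ->
  injective psi.
Proof.
move=> LE lpa psiV x y xy; apply/eqP; rewrite -subr_eq0; apply/eqP.
apply: contrapT => /(lpa_reduction lpa LE)[a [b [v [r [r0 rE]]]]].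
have psi0 : psi (x - y) = 0 by rewrite (raddfB psi) /= xy subrr.
have psiM z t : psi (z * t)%g = (psi z * psi t)%g by rewrite gmulfM.
by apply: (psiV v r r0); rewrite -rE !psiM psi0 nurmul0r nurmul0l.
Qed.
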